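(* Let $\epsilon>0$ be a constant. Any deterministic clock auction that is augmented with a prediction $\hat{\texttt{OPT}}$ and is $(1+\epsilon)$-consistent has robustness $\Omega\!\left(\frac{1}{\epsilon}\log n\right)$, where $n$ is the number of bidders.
   Context: Setting: a set $N$ of $n$ bidders with private values $v_i\ge v_{\min}>0$; a public downward-closed family $\mathcal F\subseteq 2^N$ of feasible sets; $v(S)=\sum_{i\in S}v_i$; $\texttt{OPT}(I)$ is a maximum-value feasible set of instance $I$. A clock auction offers each active bidder personalized prices that are non-decreasing over time and depend only on public information (feasibility system, prediction, price history, exit history); a bidder stays while the price is at most her value and otherwise permanently exits; the auction ends when the active set is feasible and serves it. A learning-augmented auction $\mathcal M$ additionally receives a prediction $\hat{\texttt{OPT}}\in\mathcal F$ (possibly wrong). Robustness: $\max_{I,\hat{\texttt{OPT}}}v(\texttt{OPT}(I))/v(\mathcal M(I,\hat{\texttt{OPT}}))$. Consistency: $\max_I v(\texttt{OPT}(I))/v(\mathcal M(I,\texttt{OPT}(I)))$. $c$-consistent means consistency at most $c$. *)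

(* Defs.v *)
From HB Require Import structures.
From mathcomp Require Import all_boot all_order all_algebra.
From mathcomp Require Import all_classical all_reals all_analysis.
Set Implicit Arguments. Unset Strict Implicit. Unset Printing Implicit Defensive.
Import Order.TTheory GRing.Theory Num.Theory.
Local Open Scope ring_scope.

Section ClockAuctions.
Variables (R : realType) (n : nat).

(* bidders are 'I_n ; a feasibility system is a family of bidder sets *)
Definition family := {set {set 'I_n}}.

Definition downward_closed (F : family) : Prop :=
  forall S T : {set 'I_n}, S \in F -> T \subset S -> T \in F.

Definition val (v : 'I_n -> R) (S : {set 'I_n}) : R := \sum_(i in S) v i.

Definition is_opt (F : family) (v : 'I_n -> R) (S : {set 'I_n}) : Prop :=
  S \in F /\ forall T, T \in F -> val v T <= val v S.

Definition instance (vmin : R) (F : family) (v : 'I_n -> R) : Prop :=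
  downward_closed F /\ forall i, vmin <= v i.

(* Public exit history: for each completed stage, the (stage-local) time at
   which the next exits happened and the set of bidders who exited then. *)
Definition history := seq (R * {set 'I_n}).

(* A deterministic learning-augmented clock auction: given the public
   information (feasibility system, prediction, exit history) it commits to a
   personalized price path (price of bidder i at stage-local time t >= 0)
   that is followed until the next exit event.  Price history is a function of
   these public data since the auction is deterministic. *)
Definition clock_auction := family -> {set 'I_n} -> history -> R -> 'I_n -> R.

Definition valid_clock (M : clock_auction) : Prop :=
  (forall F p h i t t', 0 <= t -> t <= t' -> M F p h t i <= M F p h t' i) /\
  (forall F p h tau S i, 0 <= tau -> M F p h tau i <= M F p (rcons h (tau, S)) 0 i).

Definition exits_at (phi : R -> R) (x tau : R) : Prop :=
  (forall t, 0 <= t -> t < tau -> phi t <= x) /\ (forall t, tau < t -> x < phi t).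

Definition survives_past (phi : R -> R) (x tau : R) : Prop :=
  exists t, tau < t /\ phi t <= x.

(* outcome M F p v h A W : running auction M on feasibility F, prediction p,
   values v, from exit history h with active set A, serves W.
   The auction stops as soon as the active set is feasible and serves it;
   if the active set is infeasible and nobody ever exits, nothing is served. *)
Inductive outcome (M : clock_auction) (F : family) (p : {set 'I_n})
    (v : 'I_n -> R) : history -> {set 'I_n} -> {set 'I_n} -> Prop :=
| Out_feasible h A : A \in F -> outcome M F p v h A A
| Out_stall h A : A \notin F ->
    (forall i t, i \in A -> 0 <= t -> M F p h t i <= v i) ->
    outcome M F p v h A finset.set0
| Out_step (h : history) (A : {set 'I_n}) (tau : R) (S W : {set 'I_n}) : A \notin F -> 0 <= tau -> S \subset A -> S != finset.set0 ->
    (forall i, i \in S -> exits_at (fun t => M F p h t i) (v i) tau) ->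
    (forall i, i \in A :\: S -> survives_past (fun t => M F p h t i) (v i) tau) ->
    outcome M F p v (rcons h (tau, S)) (A :\: S) W ->
    outcome M F p v h A W.

Definition auction_outcome (M : clock_auction) (F : family) (p : {set 'I_n})
    (v : 'I_n -> R) (W : {set 'I_n}) : Prop :=
  outcome M F p v [::] [set: 'I_n] W.

Definition consistent_within (vmin : R) (M : clock_auction) (alpha : R) : Prop :=
  forall F v, instance vmin F v -> forall S, is_opt F v S ->
  forall W, auction_outcome M F S v W -> val v S <= alpha * val v W.

(* robustness at least r: the supremum over instances and predictions of
   v(OPT)/v(M) (with x/0 = +oo for x > 0) is >= r *)
Definition robustness_at_least (vmin : R) (M : clock_auction) (r : R) : Prop :=
  forall r', r' < r -> exists F v p S W,
    [/\ instance vmin F v, p \in F, is_opt F v S, auction_outcome M F p v W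
      & r' * val v W < val v S].

End ClockAuctions.

(* Main.v *)
(* Two disjoint groups of about n/2 bidders; a set is feasible iff it lies in
   one group, and the first group is predicted. An adversary fixes the values
   online. A group with budget c and k active bidders pretends that each of
   them has value c/k: a bidder exits as soon as her price passes c/k. Thus the
   active part of a group is always worth c, while a group that has exited
   completely was worth c (1 + 1/2 + ... + 1/m). The budgets are e for the other
   group and 3 eps e for the predicted one. If all but one of the predicted
   bidders exit, giving the last one the total value e H_m of the other group
   makes the prediction correct and contradicts (1 + eps)-consistency. So the
   other group exits completely (or nothing is served): welfare at most 3 eps e
   is obtained while e H_m was available. *)

Require Import Defs.
From HB Require Import structures.
From mathcomp Require Import all_boot all_order all_algebra.
From mathcomp Require Import all_classical all_reals all_analysis.
From mathcomp Require Import ring lra zify.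
Set Implicit Arguments. Unset Strict Implicit. Unset Printing Implicit Defensive.
Import Order.TTheory GRing.Theory Num.Theory.
Local Open Scope ring_scope.

(** * Exit times along non-decreasing price paths *)

Section PricePaths.
Context {R : realType}.
Implicit Types (phi : R -> R) (x tau t : R).

(** The exit time is the supremum of the times with an acceptable price, or 0 if even the starting
    price is too high. [exits_at] leaves the price at [tau] itself open, so jumps are harmless. *)
Lemma exit_time phi x :
    (forall t t', 0 <= t -> t <= t' -> phi t <= phi t') ->
  (forall t, 0 <= t -> phi t <= x) \/ exists2 tau, 0 <= tau & exits_at phi x tau.
Proof.
move=> phi_mono; have [?|/existsNP[t0 /not_implyP[t0_ge0 /negP]]] :=
  pselect (forall t, 0 <= t -> phi t <= x); [by left | rewrite -ltNge => t0x].
right; pose E : set R := fun t => 0 <= t /\ phi t <= x.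
have ubE : has_ubound E.
  exists t0 => t [t_ge0 tx]; rewrite leNgt; apply/negP => /ltW t0t.
  by have := le_lt_trans (le_trans (phi_mono _ _ t0_ge0 t0t) tx) t0x; rewrite ltxx.
have [[t1 Et1]|E0] := pselect (exists t, E t).
  have Esup : has_sup E by split; [exists t1 | ].
  have sup_ge0 : 0 <= sup E by apply: le_trans (ub_le_sup ubE Et1); case: Et1.
  exists (sup E) => //; split=> t.
    move=> t_ge0; rewrite -subr_gt0 => /(sup_adherent)/(_ Esup)[e [e0 ex]].
    by rewrite opprB addrC subrK => /ltW te; apply: le_trans ex; exact: phi_mono.
  move=> supt; rewrite ltNge; apply/negP => tx.
  have : t <= sup E by apply: ub_le_sup => //; split=> //; apply/ltW/(le_lt_trans sup_ge0).
  by rewrite leNgt supt.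
exists 0 => //; split=> t; first by move=> t_ge0; rewrite ltNge t_ge0.
by move=> /ltW t_ge0; rewrite ltNge; apply/negP => tx; apply: E0; exists t.
Qed.

Lemma exits_later_survives phi x tau tau' :
  0 <= tau -> tau < tau' -> exits_at phi x tau' -> survives_past phi x tau.
Proof.
move=> tau0 ltt [before _]; exists ((tau + tau') / 2); split; first by lra.
by apply: before; lra.
Qed.

Lemma exits_not_survives phi x tau : exits_at phi x tau -> ~ survives_past phi x tau.
Proof. by move=> [_ after] [t [/after]]; rewrite ltNge => /negP. Qed.

Lemma survives_pastW phi x x' tau :
  x <= x' -> survives_past phi x tau -> survives_past phi x' tau.
Proof. by move=> xx' [t [tt tx]]; exists t; split=> //; apply: le_trans xx'. Qed.

Lemma exits_or_survives phi x tau :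
    (forall t, 0 <= t -> t < tau -> phi t <= x) ->
  exits_at phi x tau \/ survives_past phi x tau.
Proof.
move=> before; have [|nsurv] := pselect (survives_past phi x tau); [by right | left].
split=> // t ltt; rewrite ltNge; apply/negP => tx; apply: nsurv; by exists t.
Qed.

Lemma first_exit (I : finType) (A : {set I}) (phi : R -> I -> R) (v : I -> R) :
    (forall i t t', 0 <= t -> t <= t' -> phi t i <= phi t' i) ->
  (forall i t, i \in A -> 0 <= t -> phi t i <= v i) \/
  exists tau, [/\ 0 <= tau,
    forall i, i \in A -> exits_at (phi^~ i) (v i) tau \/ survives_past (phi^~ i) (v i) tau,
    forall i t, i \in A -> 0 <= t -> t < tau -> phi t i <= v i &
    exists2 i, i \in A & exits_at (phi^~ i) (v i) tau].
Proof.
move=> phi_mono.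
(* Bidders who never exit get a dummy time; [Q] sorts them out, and the first exit is the minimum of
   [T] over [Q]. *)
pose P i t := (forall s, 0 <= s -> phi s i <= v i) \/
  (0 <= t /\ exits_at (phi^~ i) (v i) t).
have /choice[T TP] : forall i, exists t, P i t.
  move=> i; have [?|[t t0 ?]] := @exit_time (phi^~ i) (v i) (phi_mono i).
    by exists 0; left.
  by exists t; right.
pose Q i := (i \in A) && `[< 0 <= T i /\ exits_at (phi^~ i) (v i) (T i) >].
case: (pickP Q) => [i0 Qi0|Q0]; last first.
  left=> i t iA t0; case: (TP i) => [|ex]; first exact.
  by have := Q0 i; rewrite /Q iA /= => /asboolPn.
right; case: (arg_minP T Qi0) => i /andP[iA /asboolP[Ti0 exi]] Tmin.
have dich j : j \in A ->
    exits_at (phi^~ j) (v j) (T i) \/ survives_past (phi^~ j) (v j) (T i).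
  move=> jA; case: (TP j) => [stay|ex].
    by right; exists (T i + 1); split; [lra | apply: stay; lra].
  have := Tmin j; rewrite /Q jA /= => /(_ (asboolT ex)).
  case: ex => _ ex; rewrite le_eqVlt => /orP[/eqP ->|ltT]; first by left.
  by right; exact: exits_later_survives ex.
exists (T i); split=> //; last by exists i.
move=> j t jA t0 tT; case: (dich j jA) => [[+ _]|[s [Ts sx]]]; first exact.
by apply: le_trans sx; apply: phi_mono => //; apply: ltW (lt_trans tT Ts).
Qed.

End PricePaths.

(** * Runs of the auction *)

Section Outcomes.
Context {R : realType} {n : nat}.
Variables (M : clock_auction R n) (F : Defs.family n) (p : {set 'I_n}) (v : 'I_n -> R).
Implicit Types (h : history R n) (A W : {set 'I_n}).

(** Every stage that does not end the auction removes a bidder. Consistency speaks only of existing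
    outcomes, so refuting it requires one. *)
Lemma outcome_exists h A : valid_clock M -> exists W, outcome M F p v h A W.
Proof.
move=> [M_mono _]; have [k] := ubnP #|A|; elim: k h A => // k IH h A cardA.
have [AF|AnF] := boolP (A \in F); first by exists A; exact: Out_feasible.
have [stall|[tau [tau0 dich _ [i iA exi]]]] := @first_exit R _ A (M F p h) v
  (fun i t t' => @M_mono F p h i t t').
  by exists finset.set0; exact: Out_stall.
pose S := [set j in A | `[< exits_at ((M F p h)^~ j) (v j) tau >]].
have SA : S \subset A by apply/fintype.subsetP => j; rewrite inE => /andP[].
have iS : i \in S by rewrite inE iA; apply/asboolP.
have [W outW] : exists W, outcome M F p v (rcons h (tau, S)) (A :\: S) W.
  apply: IH; rewrite ltnS in cardA; apply: leq_trans cardA.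
  apply: proper_card; rewrite properE finset.subsetDl /=; apply/fintype.subsetPn.
  by exists i => //; rewrite inE iS.
exists W; apply: Out_step tau0 SA _ _ _ outW => //.
- by apply/finset.set0Pn; exists i.
- by move=> j; rewrite inE => /andP[_ /asboolP].
move=> j; rewrite !inE => /andP[/nandP jS jA]; case: (dich j jA) => // exj.
by case: jS => /negP []; rewrite ?jA//; apply/asboolP.
Qed.

Lemma outcome_subset h A W : outcome M F p v h A W -> W \subset A.
Proof.
elim=> {h A W} [//|h A _ _|h A tau S W _ _ _ _ _ _ _ WA]; first exact: finset.sub0set.
exact: fintype.subset_trans WA (finset.subsetDl _ _).
Qed.

Lemma outcome_feasible h A W :
  finset.set0 \in F -> outcome M F p v h A W -> W \in F.
Proof. by move=> F0; elim. Qed.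

End Outcomes.

(** * Harmonic numbers: [H k] is 1 + 1/2 + ... + 1/k *)

Section HarmonicSeries.
Context {R : realType}.
Local Notation H k := (series (@harmonic R) k).

Lemma harmonic_series0 : H 0 = 0.
Proof. by rewrite /series /= big_geq. Qed.

Lemma harmonic_series1 : H 1 = 1.
Proof. by rewrite /series /= big_nat1 invr1. Qed.

Lemma harmonic_series_mono k l : (k <= l)%N -> H k <= H l.
Proof. by apply: nondecreasing_series => i _ _; exact: harmonic_ge0. Qed.

Lemma harmonic_series_ge1 k : (0 < k)%N -> 1 <= H k.
Proof. by rewrite -harmonic_series1; exact: harmonic_series_mono. Qed.

Lemma ln_le_harmonic_series k : ln k.+1%:R <= H k.
Proof.
elim: k => [|k IH]; first by rewrite harmonic_series0 ln1.
(* This factorisation reduces the inductive step to ln (1 + x) <= x. *)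
rewrite seriesSr (_ : k.+2%:R = k.+1%:R * (1 + k.+1%:R^-1)); last first.
  by rewrite mulrDr mulr1 mulfV ?pnatr_eq0// -natr1.
have inv_gt0 : 0 < (k.+1%:R : R)^-1 by rewrite invr_gt0 ltr0n.
have inv1_gt0 : 0 < 1 + (k.+1%:R : R)^-1 by rewrite addr_gt0.
rewrite lnM ?posrE ?ltr0n//; apply: lerD => //; apply: le_ln1Dx.
by apply: lt_trans inv_gt0; rewrite ltrN10.
Qed.

End HarmonicSeries.

(** * Pretended values and the total value of the exited bidders *)

Section Shares.
Context {R : realType} {n : nat}.
Variables (c : bool -> R) (g : 'I_n -> bool).
Implicit Types (A T : {set 'I_n}) (w : 'I_n -> R).

Local Notation H k := (series (@harmonic R) k).

Definition group b : {set 'I_n} := [set i | g i == b].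

(** The value that [i] pretends to have while [A] is active; [c] gives the budget of each group. *)
Definition share A i : R := c (g i) / #|A :&: group (g i)|%:R.

(* The bidders outside [A] exited with the values that their shares had at the
   moment of their exits, one after the other: c / m, c / (m - 1), ... *)
Definition harmonic_exits A w : Prop := forall b,
  Defs.val w (group b :\: A) = c b * (H #|group b| - H #|A :&: group b|).

Lemma harmonic_exitsT w : harmonic_exits [set: 'I_n] w.
Proof. by move=> b; rewrite finset.setDT finset.setTI subrr mulr0 /Defs.val big_set0. Qed.

(** Fewer active bidders divide the same budget, so prices accepted under an earlier share stay
    accepted later. *)
Lemma share_le A T i : (forall b, 0 <= c b) -> T \subset A -> i \in T ->
  share A i <= share T i.
Proof.
move=> c_ge0 TA iT; rewrite /share ler_wpM2l// lef_pV2 ?posrE ?ltr0n ?ler_nat.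
- by apply: subset_leq_card; apply: finset.setSI.
- by apply/card_gt0P; exists i; rewrite !inE (fintype.subsetP TA)//=.
- by apply/card_gt0P; exists i; rewrite !inE iT /=.
Qed.

Lemma share_lb A i m : (forall b, m <= c b / n%:R) -> (forall b, 0 <= c b) -> i \in A ->
  m <= share A i.
Proof.
move=> mc c_ge0 iA; apply: le_trans (mc (g i)) _; rewrite /share ler_wpM2l//.
have k0 : (0 < #|A :&: group (g i)|)%N by apply/card_gt0P; exists i; rewrite !inE iA /=.
have kn : (#|A :&: group (g i)| <= n)%N by rewrite -[leqRHS]card_ord max_card.
by rewrite lef_pV2 ?posrE ?ltr0n ?ler_nat//; apply: leq_trans kn.
Qed.

Lemma val_share A b : (A :&: group b != finset.set0) ->
  Defs.val (share A) (A :&: group b) = c b.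
Proof.
rewrite -card_gt0 => k0; rewrite /Defs.val.
rewrite (eq_bigr (fun=> c b / #|A :&: group b|%:R)).
  by rewrite sumr_const -[LHS]mulr_natr divfK// pnatr_eq0 -lt0n.
by move=> i; rewrite !inE /share => /andP[_ /eqP ->].
Qed.

(** An exit from a group with k active members adds c / k, which is c times the difference of [H k]
    and [H (k - 1)]. *)
Lemma harmonic_exitsD1 A w i : i \in A -> harmonic_exits A w ->
  harmonic_exits (A :\ i) (fun j => if j == i then share A i else w j).
Proof.
move=> iA exA b; have [gi|gi] := eqVneq (g i) b; last first.
  have -> : (A :\ i) :&: group b = A :&: group b.
    by apply/setP => j; rewrite !inE; case: (eqVneq j i) => // ->; rewrite (negPf gi) !andbF.
  rewrite -exA; have -> : group b :\: (A :\ i) = group b :\: A.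
    by apply/setP => j; rewrite !inE; case: (eqVneq j i) => // ->; rewrite (negPf gi) !andbF.
  by apply: eq_bigr => j; rewrite !inE; case: (eqVneq j i) => // ->; rewrite iA.
have -> : group b :\: (A :\ i) = i |: (group b :\: A).
  by apply/setP => j; rewrite !inE; case: (eqVneq j i) => //= ->; rewrite gi eqxx.
rewrite /Defs.val big_setU1 ?inE ?iA//= eqxx.
rewrite (eq_bigr w); last by move=> j; rewrite !inE; case: (eqVneq j i) => // ->; rewrite iA.
have := exA b; rewrite /Defs.val => ->.
have -> : (A :\ i) :&: group b = (A :&: group b) :\ i by rewrite finset.setIDAC.
have iAb : i \in A :&: group b by rewrite !inE iA gi /=.
rewrite (cardsD1 i (A :&: group b)) iAb add1n /share gi (cardsD1 i (A :&: group b)) iAb.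
by rewrite add1n seriesSr /harmonic /=; ring.
Qed.

(** A price jump can make several bidders leave at the same [tau]. They are removed one by one, each
    valued at her share at that moment, which raises the shares of the others in her group, until
    all who remain survive past [tau]. The last member of [keep] is never removed, so she alone may
    fail to survive. *)
Lemma saturated_exits (phi : R -> 'I_n -> R) A w tau (keep : {set 'I_n}) :
    (forall b, 0 <= c b) -> keep :&: A != finset.set0 -> harmonic_exits A w ->
    (forall i t, i \in A -> 0 <= t -> t < tau -> phi t i <= share A i) ->
  exists (S : {set 'I_n}) w', [/\ [/\ S \subset A, harmonic_exits (A :\: S) w' & keep :&: (A :\: S) != finset.set0],
    forall i, i \notin A -> w' i = w i,
    forall i, i \in S -> share A i <= w' i /\ exits_at (phi^~ i) (w' i) tau &
    forall i, i \in A :\: S ->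
      survives_past (phi^~ i) (share (A :\: S) i) tau \/ keep :&: (A :\: S) = [set i]].
Proof.
move=> c_ge0 keepA exA before.
pose good (S : {set 'I_n}) w' := [/\ [/\ S \subset A, harmonic_exits (A :\: S) w' & keep :&: (A :\: S) != finset.set0],
    forall i, i \notin A -> w' i = w i &
    forall i, i \in S -> share A i <= w' i /\ exits_at (phi^~ i) (w' i) tau].
suff step k (S : {set 'I_n}) w' : (#|A :\: S| < k)%N -> good S w' -> exists S w', good S w' /\
    forall i, i \in A :\: S ->
      survives_past (phi^~ i) (share (A :\: S) i) tau \/ keep :&: (A :\: S) = [set i].
  have [|S [w' [[? ? ?] ?]]] := step _ finset.set0 w (ltnSn _); last by exists S, w'.
  by split=> [|//|i]; rewrite ?finset.setD0 ?inE// finset.sub0set.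
elim: k S w' => // k IH S w' cardS goodS; case: (goodS) => -[SA exS keepS] w'w exitS.
have [sat|/existsNP[i /not_implyP[iAS /not_orP[nsurv /eqP keepi]]]] := pselect (forall i, i \in A :\: S ->
  survives_past (phi^~ i) (share (A :\: S) i) tau \/ keep :&: (A :\: S) = [set i]).
  by exists S, w'.
have iA : i \in A by case/finset.setDP: iAS.
have iS : i \notin S by case/finset.setDP: iAS.
(* All prices before [tau] were below the smaller initial share, so failing to survive under the
   current share means exiting exactly at [tau]. *)
have lei := share_le c_ge0 (finset.subsetDl A S) iAS.
apply: (IH (i |: S) (fun j => if j == i then share (A :\: S) i else w' j)).
  rewrite ltnS in cardS; apply: leq_trans cardS; apply: proper_card.
  by rewrite finset.setUC -finset.setDDl; apply: finset.properD1.
rewrite /good [i |: S]finset.setUC -finset.setDDl; split.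
- split; first by rewrite finset.subUset SA finset.sub1set.
    exact: harmonic_exitsD1.
  have [j jk ji] : exists2 j, j \in keep :&: (A :\: S) & j != i.
    apply/exists_inP; apply: contraT => /exists_inPn all_i; case/negP: keepi.
    case/finset.set0Pn: keepS => j jk; have /negPn/eqP ji := all_i j jk.
    rewrite finset.eqEsubset finset.sub1set -{2}ji jk andbT; apply/fintype.subsetP => l /all_i /negPn/eqP ->.
    exact: finset.set11.
  by apply/finset.set0Pn; exists j; move: jk; rewrite !inE ji.
- by move=> j jA; case: (eqVneq j i) jA => [->|_ jA]; rewrite ?iA// w'w.
move=> j; rewrite !inE; case: (eqVneq j i) => [-> _|ji /=]; last by rewrite orbF => /exitS.
split=> //; case: (@exits_or_survives _ (phi^~ i) (share (A :\: S) i) tau) => //.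
by move=> t t0 tt; apply: le_trans lei; exact: before.
Qed.

End Shares.

(** * The feasibility system of two disjoint groups *)

Section TwoGroups.
Context {R : realType} {n : nat}.
Variable g : 'I_n -> bool.
Implicit Types (A T W : {set 'I_n}) (v : 'I_n -> R).

Definition two_groups : Defs.family n :=
  [set T : {set 'I_n} | (T \subset group g true) || (T \subset group g false)].

Lemma two_groups_downward_closed : downward_closed two_groups.
Proof.
by move=> S T; rewrite !inE => /orP[] SG TS; rewrite (fintype.subset_trans TS SG) ?orbT.
Qed.

Lemma two_groups_set0 : finset.set0 \in two_groups.
Proof. by rewrite inE finset.sub0set. Qed.

Lemma val_subset v A T : (forall i, 0 <= v i) -> A \subset T -> Defs.val v A <= Defs.val v T.
Proof.
move=> v_ge0 AT; rewrite /Defs.val [leRHS](big_setID A)/= (finset.setIidPr AT).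
by rewrite lerDl sumr_ge0.
Qed.

Lemma val_setID v A T : Defs.val v T = Defs.val v (A :&: T) + Defs.val v (T :\: A).
Proof. by rewrite /Defs.val (big_setID A) finset.setIC. Qed.

Lemma group_opt v : (forall i, 0 <= v i) ->
  Defs.val v (group g false) <= Defs.val v (group g true) ->
  is_opt two_groups v (group g true).
Proof.
move=> v_ge0 le_groups; split=> [|T]; first by rewrite inE subxx.
rewrite inE => /orP[TG|TG]; first exact: val_subset.
by apply: le_trans le_groups; exact: val_subset.
Qed.

End TwoGroups.

(** * The adversary's strategy *)

Section Adversary.
Context {R : realType} {n : nat}.
Variables (M : clock_auction R n) (g : 'I_n -> bool) (c : bool -> R) (vmin alpha : R).
Implicit Types (A S W : {set 'I_n}) (v w : 'I_n -> R) (h : history R n).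

Local Notation H k := (series (@harmonic R) k).
Local Notation F := (two_groups g).
Local Notation predicted := (group g true).
Local Notation other := (group g false).
(** The value of the other group once all its members have exited. *)
Local Notation V := (c false * H #|other|).

Hypothesis M_valid : valid_clock M.
Hypothesis M_consistent : consistent_within vmin M alpha.
Hypothesis vmin_gt0 : 0 < vmin.
Hypothesis c_ge0 : forall b, 0 <= c b.
Hypothesis vmin_le : forall b, vmin <= c b / n%:R.
Hypothesis c_le : forall b, c b <= V.
Hypothesis alpha_ge0 : 0 <= alpha.
(** The right side is the value of the predicted group when all but one of its bidders have exited
    and the last is worth [V]; serving only [V] then violates consistency. *)
Hypothesis alphaV : alpha * V < V + c true * (H #|predicted| - 1).

(** With k > 0 active members the active part is worth [c false], while the exited part falls short
    of [V] by [c false * H k], and [H k] is at least 1. *)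
Lemma val_other_le A v w : harmonic_exits c g A w ->
  (forall i, i \in A :&: other -> v i = share c g A i) -> (forall i, i \in other :\: A -> v i = w i) ->
  Defs.val v other <= V.
Proof.
move=> exA vA vnA; rewrite (val_setID v A) /Defs.val (eq_bigr _ vA) (eq_bigr _ vnA).
have := exA false; rewrite /Defs.val => ->.
have [->|A0] := eqVneq (A :&: other) finset.set0.
  by rewrite big_set0 add0r cards0 harmonic_series0 subr0.
have := val_share c A0; rewrite /Defs.val => ->.
rewrite -card_gt0 in A0.
rewrite -[X in X + _]mulr1 -mulrDr ler_wpM2l// -[leRHS]add0r addrA addrAC lerD2r.
by rewrite subr_le0 harmonic_series_ge1.
Qed.

(* If a single predicted bidder [a] remained, raising her value to [V] would
   make the predicted group optimal, while the exits from that group would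
   already have cost more than the consistency guarantee allows. *)
Lemma last_predicted_bidder A S w w' h tau a :
    A \notin F -> 0 <= tau -> S \subset A -> S != finset.set0 ->
    harmonic_exits c g (A :\: S) w' -> predicted :&: (A :\: S) = [set a] ->
    (forall i, i \notin A -> w' i = w i) -> (forall i, i \notin A -> vmin <= w i) ->
    (forall i, i \in S -> share c g A i <= w' i /\
      exits_at ((M F predicted h)^~ i) (w' i) tau) ->
    (forall i, i \in A :\: S ->
      survives_past ((M F predicted h)^~ i) (share c g (A :\: S) i) tau \/ i = a) ->
    (forall i t, i \in A -> 0 <= t -> t < tau -> M F predicted h t i <= share c g A i) ->
    (forall v, (forall i, i \notin A -> v i = w i) ->
       (forall i, i \in A -> share c g A i <= v i) ->
       forall W, outcome M F predicted v h A W -> auction_outcome M F predicted v W) ->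
  False.
Proof.
move=> AF tau0 SA S0 exA' predA w'w wmin exitS survA before reach.
set A' := A :\: S in exA' predA survA.
have A'A : A' \subset A by exact: finset.subsetDl.
have /finset.setIP[a_pred aA'] : a \in predicted :&: A' by rewrite predA finset.set11.
have aA := fintype.subsetP A'A _ aA'.
have share_a : share c g A' a = c true.
  move: (a_pred); rewrite inE => /eqP ga.
  by rewrite /share ga finset.setIC predA cards1 divr1.
pose v i := if i == a then V else if i \in A' then share c g A' i else w' i.
have vA i : i \in A' -> share c g A' i <= v i.
  by move=> iA'; rewrite /v iA'; case: eqVneq => // ->; rewrite share_a.
have vS i : i \in S -> v i = w' i.
  by rewrite /v => iS; case: eqVneq iS aA' => [->|_] iS; rewrite /A' !inE iS.
have AE i : i \in A -> (i \in S) || (i \in A') by move=> iA; rewrite /A' !inE iA andbT orbN.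
have vn i : i \notin A -> v i = w i.
  move=> iA; rewrite /v; case: eqVneq iA => [->|_] iA; first by rewrite aA in iA.
  by rewrite (contraNF (fintype.subsetP A'A i) iA) w'w.
have lev i : i \in A -> share c g A i <= v i.
  move=> iA; case/orP: (AE i iA) => [iS|iA']; first by rewrite vS//; case: (exitS i iS).
  by apply: le_trans (vA _ iA'); exact: share_le.
have v_min i : vmin <= v i.
  have [iA|iA] := boolP (i \in A); last by rewrite vn// wmin.
  by apply: le_trans (lev _ iA); exact: share_lb.
have v_ge0 i : 0 <= v i by apply: le_trans (v_min i); exact: ltW.
(* Even at value [V] bidder [a] may exit at [tau], so the exits are recomputed for [v]. They include
   [S], hence the served set lies in [A']. *)
pose S' := [set i in A | `[< exits_at ((M F predicted h)^~ i) (v i) tau >]].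
have S'A : S' \subset A by apply/fintype.subsetP => i; rewrite inE => /andP[].
have SS' : S \subset S'.
  apply/fintype.subsetP => i iS; rewrite inE (fintype.subsetP SA)//=.
  by apply/asboolP; rewrite vS//; case: (exitS i iS).
have [W outW] := @outcome_exists _ _ M F predicted v (rcons h (tau, S')) (A :\: S') M_valid.
have WA' : W \subset A'.
  by apply: fintype.subset_trans (outcome_subset outW) _; apply: finset.setDS.
have WF := outcome_feasible (two_groups_set0 g) outW.
have {outW} outW : auction_outcome M F predicted v W.
  apply: (reach v) => //; apply: Out_step outW => //.
  - by apply: contra_neq S0 => S'0; apply/eqP; rewrite -finset.subset0 -S'0.
  - by move=> i; rewrite inE => /andP[_ /asboolP].
  move=> i /finset.setDP[iA]; rewrite inE iA /= => /asboolPn nexit.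
  have [|//|//] := @exits_or_survives _ ((M F predicted h)^~ i) (v i) tau.
  by move=> t t0 tt; apply: le_trans (lev _ iA); exact: before.
have V_pred : Defs.val v predicted = V + c true * (H #|predicted| - 1).
  rewrite (val_setID v A') [A' :&: _]finset.setIC predA {1}/Defs.val big_set1 {1}/v eqxx.
  congr (_ + _); have := exA' true; rewrite [A' :&: _]finset.setIC predA cards1.
  rewrite harmonic_series1 => <-; apply: eq_bigr => i.
  by rewrite /v => /finset.setDP[_ iA']; rewrite (negPf iA'); case: eqVneq iA' => // ->; rewrite aA'.
have ne_alt i : i \in other -> (i == a) = false.
  by apply: contraTF => /eqP ->; move: a_pred; rewrite !inE => /eqP ->.
have V_alt : Defs.val v other <= V.
  apply: (val_other_le exA') => i; rewrite /v.
    by move=> /finset.setIP[iA' i_alt]; rewrite ne_alt// iA'.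
  by move=> /finset.setDP[i_alt iA']; rewrite ne_alt// (negPf iA').
have V_ge0 : 0 <= V by apply: le_trans (c_le true); exact: c_ge0.
have predH : 0 <= c true * (H #|predicted| - 1).
  apply: mulr_ge0 => //; rewrite subr_ge0 harmonic_series_ge1//.
  by apply/card_gt0P; exists a.
have opt : is_opt F v predicted.
  by apply: group_opt => //; rewrite V_pred; apply: le_trans V_alt _; rewrite lerDl.
have := M_consistent (conj (@two_groups_downward_closed n g) v_min) opt outW.
apply/negP; rewrite -ltNge V_pred; apply: le_lt_trans alphaV; apply: ler_wpM2l => //.
(* A served set in the predicted group is contained in {a}; one in the other group is bounded by
   [V_alt]. Both are worth at most [V]. *)
move: WF; rewrite inE => /orP[W_pred|W_alt].
  have Wa : W \subset [set a] by rewrite -predA finset.subsetI W_pred.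
  by apply: le_trans (val_subset v_ge0 Wa) _; rewrite /Defs.val big_set1 /v eqxx.
by apply: le_trans (val_subset v_ge0 W_alt) _.
Qed.

(** Induction on the number of active bidders. By [reach], the state ([h], [A]) arises under every
    valuation that keeps the recorded exits and gives active bidders at least their shares, so
    active values may still be raised. *)
Lemma adversary A w h : (1 < #|predicted :&: A|)%N -> harmonic_exits c g A w ->
    (forall i, i \notin A -> vmin <= w i) ->
    (forall v, (forall i, i \notin A -> v i = w i) ->
       (forall i, i \in A -> share c g A i <= v i) ->
       forall W, outcome M F predicted v h A W -> auction_outcome M F predicted v W) ->
  exists v W, [/\ forall i, vmin <= v i, auction_outcome M F predicted v W &
    W = finset.set0 \/ Defs.val v W <= c true /\ V <= Defs.val v other].
Proof.
have [k] := ubnP #|A|; elim: k A w h => // k IH A w h cardA predA exA wmin reach.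
pose v i := if i \in A then share c g A i else w i.
have vn i : i \notin A -> v i = w i by rewrite /v => /negPf ->.
have vA i : i \in A -> v i = share c g A i by rewrite /v => ->.
have leA i : i \in A -> share c g A i <= v i by move=> /vA ->.
have v_min i : vmin <= v i.
  by rewrite /v; case: ifPn => iA; [exact: share_lb | exact: wmin].
have [AF|AF] := boolP (A \in F).
  exists v, A; split=> //; first by apply: reach => //; exact: Out_feasible.
  (* A feasible set with two predicted bidders lies in the predicted group; it is worth one budget,
     and the other group has exited completely. *)
  right; have Apred : A \subset predicted.
    move: AF; rewrite inE => /orP[//|A_alt]; case: (ltnP 1) predA => // + _.
    rewrite (_ : predicted :&: A = finset.set0) ?cards0//; apply/setP => i; rewrite !inE.
    have [iA|] := boolP (i \in A); last by rewrite andbF.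
    by move/fintype.subsetP: A_alt => /(_ i iA); rewrite inE => /eqP ->.
  have AI : A :&: predicted = A by apply/finset.setIidPl.
  have A_alt : A :&: other = finset.set0.
    apply/setP => i; rewrite !inE; have [iA|//] := boolP (i \in A).
    by move/fintype.subsetP: Apred => /(_ i iA); rewrite inE => /eqP ->.
  split.
    have /(val_share c) : A :&: predicted != finset.set0.
      by rewrite -card_gt0 finset.setIC (ltn_trans _ predA).
    by rewrite AI => <-; rewrite /Defs.val (eq_bigr _ vA).
  have := exA false; rewrite A_alt cards0 harmonic_series0 subr0 => <-.
  rewrite (val_setID v A) A_alt /Defs.val big_set0 add0r.
  by under [leRHS]eq_bigr => i /finset.setDP[_ /vn ->] do over.
have [stall|[tau [tau0 dich before [i iA exi]]]] := @first_exit R _ A (M F predicted h) (share c g A)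
  (fun i t t' => @M_valid.1 F predicted h i t t').
  exists v, finset.set0; split=> //; last by left.
  by apply: reach => //; apply: Out_stall => // i t iA t0; rewrite vA// stall.
have [|S [w' [[SA exA' keep] w'w exitS sat]]] :=
  @saturated_exits _ _ c g (M F predicted h) A w tau predicted c_ge0 _ exA before.
  by rewrite -card_gt0 (ltn_trans _ predA).
have S0 : S != finset.set0.
  apply/negP => /eqP S0; move: sat; rewrite S0 finset.setD0 => /(_ i iA) [].
    exact: exits_not_survives.
  by move=> predAi; rewrite predAi cards1 in predA.
have A'A : A :\: S \subset A by exact: finset.subsetDl.
(* At least one predicted bidder is kept; exactly one would contradict consistency. *)
have [predA'|] := ltnP 1 #|predicted :&: (A :\: S)|; last first.
  rewrite leq_eqVlt ltnS leqn0 cards_eq0 (negPf keep) orbF => /cards1P[a aE].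
  case: (@last_predicted_bidder A S w w' h tau a) => // j jA'.
  have [|jE] := sat j jA'; [by left | right].
  by apply: finset.set1_inj; rewrite -jE.
apply: (IH (A :\: S) w' (rcons h (tau, S))) => //.
- rewrite ltnS in cardA; apply: leq_trans cardA; apply: proper_card.
  rewrite properE A'A; apply/fintype.subsetPn; case/finset.set0Pn: S0 => j jS.
  by exists j; rewrite ?(fintype.subsetP SA)// inE jS.
- move=> j; have [jA|jA _] := boolP (j \in A); last by rewrite w'w// wmin.
  rewrite inE jA andbT negbK => /exitS[+ _]; apply: le_trans; exact: share_lb.
(* Valuations compatible with the new state have at least the old shares and reproduce this
   stage. *)
move=> u un uA' W outW; have uS j : j \in S -> u j = w' j.
  by move=> jS; apply: un; rewrite inE jS.
apply: reach.
- move=> j jA; rewrite un ?w'w//; apply: contra jA; exact: (fintype.subsetP A'A).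
- move=> j jA; have [jS|jS] := boolP (j \in S); first by rewrite uS//; case: (exitS j jS).
  have jA' : j \in A :\: S by rewrite inE jS.
  by apply: le_trans (uA' _ jA'); exact: share_le.
apply: Out_step outW => //.
- by move=> j jS; rewrite uS//; case: (exitS j jS).
move=> j jA'; case: (sat j jA') => [|jE]; first by apply: survives_pastW; exact: uA'.
by rewrite jE cards1 in predA'.
Qed.

End Adversary.

(** * Choice of groups and budgets, and the logarithmic bound *)

Section Robustness.
Context {R : realType} {n : nat}.

Lemma opt_exists (F : Defs.family n) (v : 'I_n -> R) :
  finset.set0 \in F -> exists S, is_opt F v S.
Proof.
move=> F0; case: (arg_maxP (Defs.val v) F0) => S SF S_max.
by exists S; split.
Qed.

Lemma card_ord_below k : (k <= n)%N -> #|[set i : 'I_n | (i < k)%N]| = k.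
Proof.
by move=> kn; rewrite cardsE -sum1_card -(big_ord_widen n (fun=> 1%N) kn) sum1_card card_ord.
Qed.

End Robustness.

Theorem theorem2 (R : realType) :
  exists c : R, 0 < c /\
  forall eps : R, 0 < eps ->
  exists n0 : nat, forall n : nat, (n0 <= n)%N ->
  forall vmin : R, 0 < vmin ->
  forall M : clock_auction R n,
    valid_clock M ->
    consistent_within vmin M (1 + eps) ->
    robustness_at_least vmin M (c * ln (n%:R : R) / eps).
Proof.
(* The factor 3 is the one in the predicted budget, the factor 2 comes from [H_ln]. *)
exists (1 / 6); split; first by lra.
(* The exponential forces [H n./2] to be at least 3 + 3 eps; the summand 4 gives both groups at
   least two bidders. *)
move=> eps eps_gt0; exists (Num.truncn (expR (6 + 6 * eps) : R) + 4)%N => n n_large.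
move=> vmin vmin_gt0 M M_valid M_consistent r' r'_lt.
have n_ge4 : (4 <= n)%N by apply: leq_trans n_large; rewrite leq_addl.
have n_gt0 : 0 < (n%:R : R) by rewrite ltr0n (leq_trans _ n_ge4).
have ln_n : 6 + 6 * eps <= ln (n%:R : R).
  rewrite -[leLHS]expRK ler_ln ?posrE ?expR_gt0//.
  apply: ltW (lt_le_trans (truncnS_gt _) _).
  by rewrite ler_nat (leq_trans _ n_large)// addnS ltnS leq_addr.
pose g (i : 'I_n) := (n./2 <= i)%N.
have card_other : #|group g false| = n./2.
  rewrite -[RHS](@card_ord_below n); last by lia.
  by apply: eq_card => i; rewrite !inE /g ltnNge; case: (_ <= _)%N.
have card_predicted : #|group g true| = (n - n./2)%N.
  have := cardsC (group g false); rewrite card_other card_ord => /(canRL (addKn _)) <-.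
  by apply: eq_card => i; rewrite !inE; case: (g i).
pose H k := series (@harmonic R) k.
have H_ln : ln (n%:R : R) <= 2 * H n./2.
  apply: (@le_trans _ _ (2 * ln (n./2.+1%:R : R))); last first.
    by rewrite ler_wpM2l// ln_le_harmonic_series.
  rewrite mulr_natl -lnXn ?ltr0n// ler_ln ?posrE ?n_gt0 ?exprn_gt0 ?ltr0n//.
  by rewrite -natrX ler_nat; nia.
have H_large : 3 + 3 * eps <= H n./2 by lra.
have H_mono : H n./2 <= H (n - n./2)%N by apply: harmonic_series_mono; lia.
(* The last factor makes both budgets, [e] and [3 * eps * e], at least n vmin, so that no share
   drops below [vmin]. *)
pose e := vmin * n%:R * (1 + (3 * eps)^-1).
have eps3 : 0 < (3 * eps)^-1 by rewrite invr_gt0; lra.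
have e_gt0 : 0 < e by rewrite /e !mulr_gt0// addr_gt0.
pose c b := if b then 3 * eps * e else e.
have c_gt0 b : 0 < c b by rewrite /c; case: b => //; apply: mulr_gt0 => //; apply: mulr_gt0.
have c_ge0 b : 0 <= c b by exact: ltW.
have c_n b : vmin <= c b / n%:R.
  rewrite ler_pdivlMr// /c /e; set x := vmin * n%:R.
  have x_gt0 : 0 < x by rewrite mulr_gt0.
  case: b; last by nra.
  have -> : 3 * eps * (x * (1 + (3 * eps)^-1)) = x * (1 + 3 * eps).
    by field; rewrite gt_eqF.
  by nra.
have c_le b : c b <= c false * H #|group g false|.
  rewrite card_other /c [leRHS]mulrC; case: b; last by rewrite ler_peMl ?(ltW e_gt0)//; lra.
  by apply: ler_wpM2r; [exact: ltW | lra].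
have alphaV : (1 + eps) * (c false * H #|group g false|) <
    c false * H #|group g false| + c true * (H #|group g true| - 1).
  rewrite card_other card_predicted /c -subr_gt0.
  have -> : e * H n./2 + 3 * eps * e * (H (n - n./2)%N - 1) - (1 + eps) * (e * H n./2) =
    eps * e * (3 * H (n - n./2)%N - 3 - H n./2) by ring.
  by rewrite !mulr_gt0//; lra.
have alpha_ge0 : 0 <= 1 + eps by lra.
(* Nobody has exited yet, so the recorded values 0 are dummies. *)
have [||||v [W [v_min outW W_or]]] := @adversary R n M g c vmin (1 + eps) M_valid
  M_consistent vmin_gt0 c_ge0 c_n c_le alpha_ge0 alphaV [set: 'I_n] (fun=> 0) [::].
- by rewrite finset.setIT card_predicted; clear -n_ge4; lia.
- exact: harmonic_exitsT.
- by move=> i; rewrite inE.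
- by [].
have [S opt] := opt_exists v (two_groups_set0 g).
exists (two_groups g), v, (group g true), S, W; split=> //.
- by split; [exact: two_groups_downward_closed | exact: v_min].
- by rewrite inE subxx.
have v_gt0 i : 0 < v i by exact: lt_le_trans (v_min i).
have S_other : Defs.val v (group g false) <= Defs.val v S.
  by apply: opt.2; rewrite inE subxx orbT.
have S_gt0 : 0 < Defs.val v S.
  apply: lt_le_trans S_other; have [i i_other] : exists i, i \in group g false.
    by apply/card_gt0P; rewrite card_other; clear -n_ge4; lia.
  rewrite /Defs.val (bigD1 i)//= ltr_pwDl// sumr_ge0// => j _; exact: ltW.
case: W_or => [->|[W_le other_ge]]; first by rewrite /Defs.val big_set0 mulr0.
have W_ge0 : 0 <= Defs.val v W by apply: sumr_ge0 => i _; exact: ltW.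
have [r'_le0|r'_gt0] := leP r' 0; first by apply: le_lt_trans S_gt0; exact: mulr_le0_ge0.
apply: lt_le_trans S_other; apply: lt_le_trans other_ge.
(* It remains that 3 r' eps < ln n / 2 <= [H n./2], after cancelling [e]. *)
apply: le_lt_trans (_ : r' * c true < _); first by rewrite ler_wpM2l// ltW.
rewrite ltr_pdivlMr// in r'_lt; rewrite card_other /c.
have -> : r' * (3 * eps * e) = e * (3 * (r' * eps)) by ring.
rewrite ltr_pM2l//; rewrite -/(H _); lra.
Qed.
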